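(* Let $\gamma:I\to\mathbb{E}^4$ be a smooth unit speed curve on an interval $I$ with parallel transport frame $\{T,M_1,M_2,M_3\}$, let $r:I\to\mathbb{R}$ be a smooth function, and let $M$ be the canal surface in $\mathbb{E}^4$ parametrized by $$X(u,v)=\gamma(u)+r(u)\left(M_2(u)\cos v+M_3(u)\sin v\right),$$ assumed to be regular. If $\gamma$ is a straight line, then $M$ is a Weingarten surface, i.e. its Gaussian curvature $K$ and mean curvature $H$ satisfy $K_uH_v-K_vH_u=0$ identically.
   Context: A parallel transport frame along a smooth unit speed curve $\gamma:I\to\mathbb{E}^4$ is a smooth orthonormal frame $\{T,M_1,M_2,M_3\}$ along $\gamma$ with $T=\gamma'$ satisfying $T'=k_1M_1+k_2M_2+k_3M_3$ and $M_i'=-k_iT$ for $i=1,2,3$, where $k_1,k_2,k_3:I\to\mathbb{R}$ are smooth functions. For a surface with parametrization $X(u,v)$ in $\mathbb{E}^4$, put $E=\langle X_u,X_u\rangle$, $F=\langle X_u,X_v\rangle$, $G=\langle X_v,X_v\rangle$; regular means $W^2=EG-F^2\neq 0$ everywhere. The second fundamental form is $h(X_i,X_j)$ = the component normal to the surface of the corresponding second partial derivative ($X_{uu}$, $X_{uv}$, $X_{vv}$). The Gaussian curvature is $K=\frac{1}{W^2}\left(\langle h(X_u,X_u),h(X_v,X_v)\rangle-\langle h(X_u,X_v),h(X_u,X_v)\rangle\right)$ and the mean curvature vector is $\overrightarrow{H}=\frac{1}{2W^2}\left(E\,h(X_v,X_v)-2F\,h(X_u,X_v)+G\,h(X_u,X_u)\right)$.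 When $\gamma$ is a straight line, $\overrightarrow{H}$ is a multiple of the unit normal field $n=\frac{1}{\sqrt{1+(r')^2}}\left(r'T-\cos v\,M_2-\sin v\,M_3\right)$, and the mean curvature $H$ is the function defined by $\overrightarrow{H}=H\,n$. A surface is a Weingarten surface if the Jacobian determinant $\left|\frac{\partial(K,H)}{\partial(u,v)}\right|=K_uH_v-K_vH_u$ vanishes identically. *)

(* Defs.v *)
From HB Require Import structures.
From mathcomp Require Import all_boot all_order all_algebra.
From mathcomp Require Import all_classical all_reals all_analysis.

Set Implicit Arguments.
Unset Strict Implicit.
Unset Printing Implicit Defensive.

Import Order.TTheory GRing.Theory Num.Theory.
Import numFieldNormedType.Exports.

Local Open Scope classical_set_scope.
Local Open Scope ring_scope.

(** An interval [I] may contain its endpoints, where derivatives are one-sided.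
    Functions on [I] are total functions on [R] of which only the values on [I]
    matter, so the difference quotient only uses increments [h] such that
    [h + x] stays in [I]. *)

Definition interval_domain (R : realType) (I : set R) : Prop :=
  is_interval I /\ exists a b, [/\ I a, I b & a < b].

Definition diffquot_in (R : realType) (V : normedModType R) (I : set R)
    (f : R -> V) (x : R) : set_system V :=
  (fun h : R => h^-1 *: (f (h + x) - f x)) @ within [set h | I (h + x)] 0^'.

Definition derivable_in (R : realType) (V : normedModType R) (I : set R)
  (f : R -> V) (x : R) : Prop := cvg (diffquot_in I f x).

Definition derive_in (R : realType) (V : normedModType R) (I : set R)
  (f : R -> V) (x : R) : V := lim (diffquot_in I f x).

Lemma diffquot_in_open (R : realType) (V : normedModType R) (I : set R)
    (f : R -> V) (x : R) : open I -> I x ->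
  diffquot_in I f x = (fun h : R => h^-1 *: (f (h + x) - f x)) @ 0^'.
Proof.
move=> oI Ix; suff E : within [set h | I (h + x)] 0^' = 0^' :> set_system R.
  by rewrite /diffquot_in E.
have nI : \forall h \near 0^', I (h + x).
  apply: cvg_within.
  have /(_ I) : (fun h : R => h + x) @ (0 : R) --> (0 : R) + x.
    by apply: cvgD; [exact: cvg_id|exact: cvg_cst].
  by apply; rewrite add0r; exact: open_nbhs_nbhs.
apply/seteqP; split=> A; rewrite /within /= => hA.
  by near=> h; have := (near hA h); apply=> //; near: h.
by near=> h => _; near: h.
Unshelve. all: by end_near.
Qed.

Lemma derive_in_open (R : realType) (V : normedModType R) (I : set R)
    (f : R -> V) (x : R) : open I -> I x -> derive_in I f x = derive1 f x.
Proof. by move=> oI Ix; rewrite /derive_in diffquot_in_open. Qed.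

Definition smooth_in (R : realType) (V : normedModType R) (I : set R)
    (f : R -> V) : Prop :=
  forall (n : nat) (x : R), I x -> derivable_in I (iter n (derive_in I) f) x.

Definition dot (R : realType) (x y : 'rV[R]_4) : R := (x *m y^T) 0 0.

Definition unit_speed (R : realType) (I : set R) (gamma : R -> 'rV[R]_4) : Prop :=
  forall u, I u -> dot (derive_in I gamma u) (derive_in I gamma u) = 1.

Definition straight_line (R : realType) (I : set R) (gamma : R -> 'rV[R]_4) : Prop :=
  exists p d : 'rV[R]_4, d != 0 /\
    forall u, I u -> exists t : R, gamma u = p + t *: d.

Definition orthonormal4 (R : realType) (e : 4.-tuple 'rV[R]_4) : Prop :=
  forall i j : 'I_4, dot (tnth e i) (tnth e j) = (i == j)%:R.

Record parallel_transport_frame (R : realType) (I : set R)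
    (gamma T M1 M2 M3 : R -> 'rV[R]_4) (k1 k2 k3 : R -> R) : Prop := {
  frame_smooth : [/\ smooth_in I T, smooth_in I M1, smooth_in I M2 & smooth_in I M3];
  curvatures_smooth : [/\ smooth_in I k1, smooth_in I k2 & smooth_in I k3];
  frame_orthonormal : forall u, I u -> orthonormal4 [tuple T u; M1 u; M2 u; M3 u];
  frame_tangent : forall u, I u -> T u = derive_in I gamma u;
  frame_dT : forall u, I u ->
    derive_in I T u = k1 u *: M1 u + k2 u *: M2 u + k3 u *: M3 u;
  frame_dM1 : forall u, I u -> derive_in I M1 u = - k1 u *: T u;
  frame_dM2 : forall u, I u -> derive_in I M2 u = - k2 u *: T u;
  frame_dM3 : forall u, I u -> derive_in I M3 u = - k3 u *: T u
}.

(** Functions of [(u, v)] with [u] in [I] and [v] ranging over all of [R]. *)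

Definition du (R : realType) (V : normedModType R) (I : set R)
  (f : R -> R -> V) (u v : R) : V := derive_in I (fun s => f s v) u.

Definition dv (R : realType) (V : normedModType R)
  (f : R -> R -> V) (u v : R) : V := derive1 (f u) v.

Section SurfaceGeometry.
Variables (R : realType) (I : set R) (X : R -> R -> 'rV[R]_4).

Let Xu := du I X.
Let Xv := dv X.

Definition ffE u v : R := dot (Xu u v) (Xu u v).
Definition ffF u v : R := dot (Xu u v) (Xv u v).
Definition ffG u v : R := dot (Xv u v) (Xv u v).
Definition W2 u v : R := ffE u v * ffG u v - ffF u v ^+ 2.

Definition regular_surface : Prop := forall u v, I u -> W2 u v != 0.

(** The row space of [tangent_space u v] is the tangent plane, and that of
    [kermx (tangent_space u v)^T] is its orthogonal complement. *)
Definition tangent_space u v : 'M[R]_4 := <<col_mx (Xu u v) (Xv u v)>>%MS.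

Definition normal_component u v (w : 'rV[R]_4) : 'rV[R]_4 :=
  w *m proj_mx (kermx (tangent_space u v)^T) (tangent_space u v).

Definition huu u v : 'rV[R]_4 := normal_component u v (du I Xu u v).
Definition huv u v : 'rV[R]_4 := normal_component u v (dv Xu u v).
Definition hvv u v : 'rV[R]_4 := normal_component u v (dv Xv u v).

Definition gaussian_curvature u v : R :=
  (W2 u v)^-1 * (dot (huu u v) (hvv u v) - dot (huv u v) (huv u v)).

Definition mean_curvature_vector u v : 'rV[R]_4 :=
  (2 * W2 u v)^-1 *:
    (ffE u v *: hvv u v - (2 * ffF u v) *: huv u v + ffG u v *: huu u v).

End SurfaceGeometry.

Definition canal_surface (R : realType) (gamma M2 M3 : R -> 'rV[R]_4) (r : R -> R)
    (u v : R) : 'rV[R]_4 :=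
  gamma u + r u *: (cos v *: M2 u + sin v *: M3 u).

Definition canal_normal (R : realType) (I : set R) (T M2 M3 : R -> 'rV[R]_4)
    (r : R -> R) (u v : R) : 'rV[R]_4 :=
  (Num.sqrt (1 + derive_in I r u ^+ 2))^-1 *:
    (derive_in I r u *: T u - cos v *: M2 u - sin v *: M3 u).

(** As [n] never vanishes, this determines [H u v] for every [u] in [I]; the
    values of [H] elsewhere are irrelevant. *)
Definition is_mean_curvature (R : realType) (I : set R)
    (X n : R -> R -> 'rV[R]_4) (H : R -> R -> R) : Prop :=
  forall u v, I u -> mean_curvature_vector I X u v = H u v *: n u v.

Definition weingarten (R : realType) (I : set R) (K H : R -> R -> R) : Prop :=
  forall u v, I u -> du I K u v * dv H u v - dv K u v * du I H u v = 0.

(* Main.v *)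
Require Import Defs.
From HB Require Import structures.
From mathcomp Require Import all_boot all_order all_algebra.
From mathcomp Require Import all_classical all_reals all_analysis.
From mathcomp Require Import ring lra.

Import Order.TTheory GRing.Theory Num.Theory.
Import numFieldNormedType.Exports.

Local Open Scope classical_set_scope.
Local Open Scope ring_scope.

(** If [gamma] stays on a line, then [T'] is parallel to [T]; being also
    orthogonal to it, it vanishes, and so do the [k_i] and the [M_i']. With
    [N = cos v M2 + sin v M3] this leaves [X_u = T + r' N], [X_v = r N_v],
    [X_uu = r'' N], [X_uv = r' N_v] and [X_vv = - r N], whence
    [K = - r'' / (r (1 + r'^2)^2)] and
    [H = (1 + r'^2 - r r'') / (2 r (1 + r'^2)^(3/2))]. Neither depends on [v],
    so [K_v = H_v = 0]. *)

(** * Calculus of derivatives relative to a subset of the line *)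

Definition has_derive_in {R : realType} {V : normedModType R} (I : set R)
    (f : R -> V) (x : R) (l : V) : Prop := diffquot_in I f x --> l.

(** An interval with two points accumulates at each of its points, so one-sided
    derivatives at endpoints are unique. *)
Lemma interval_incr_proper {R : realType} {I : set R} {x : R} :
  interval_domain I -> I x -> ProperFilter (within [set h | I (h + x)] 0^').
Proof.
move=> [itvI [a [b [Ia Ib ab]]]] Ix; apply: Build_ProperFilter_ex.
move=> P; rewrite /within /= => /nbhs_ballP [e /= e0 eP].
(* If [x < b] there is room to the right of [x]; otherwise [a < b <= x] gives room to the left. The
   minimum keeps the increment inside the ball and the moved point inside [I]. *)
have [xb|bx] := ltP x b.
- pose h := Num.min (e / 2) (b - x).
  have h0 : 0 < h by rewrite lt_min subr_gt0 xb divr_gt0.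
  have he : h < e.
    rewrite (@le_lt_trans _ _ (e / 2)) ?ge_min ?lexx//.
    by rewrite gtr_pMr// invf_lt1 ?ltr1n.
  exists h; apply: eP => /=.
  + by rewrite /ball /= sub0r normrN gtr0_norm.
  + by rewrite gt_eqF.
  + apply: (itvI x b) => //; rewrite lerDr ltW//=.
    by rewrite -lerBrDr ge_min lexx orbT.
- pose h := Num.min (e / 2) (x - a).
  have ax : a < x by apply: lt_le_trans bx.
  have h0 : 0 < h by rewrite lt_min subr_gt0 ax divr_gt0.
  have he : h < e.
    rewrite (@le_lt_trans _ _ (e / 2)) ?ge_min ?lexx//.
    by rewrite gtr_pMr// invf_lt1 ?ltr1n.
  exists (- h); apply: eP => /=.
  + by rewrite /ball /= sub0r opprK gtr0_norm.
  + by rewrite oppr_eq0 gt_eqF.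
  + apply: (itvI a x) => //; rewrite addrC gerDl oppr_le0 (ltW h0) andbT.
    by rewrite lerBrDr -lerBrDl ge_min lexx orbT.
Qed.

Lemma has_derive_inE {R : realType} {V : normedModType R} {I : set R}
    {f : R -> V} {x : R} {l : V} :
  interval_domain I -> I x -> has_derive_in I f x l -> derive_in I f x = l.
Proof.
by move=> dI Ix; have := interval_incr_proper dI Ix => ?; exact: cvg_lim.
Qed.

(** The filter only sees increments that stay in [I], so formulas known on [I] alone may be
    differentiated; this is what makes iterated [u]-derivatives computable. *)
Lemma has_derive_in_eq {R : realType} {V : normedModType R} {I : set R}
    {f : R -> V} (g : R -> V) {x : R} {l : V} :
  I x -> {in I, f =1 g} -> has_derive_in I g x l -> has_derive_in I f x l.
Proof.
move=> Ix fg; apply: cvg_trans; apply: near_eq_cvg.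
by apply: (filterS _ (@withinT _ 0^' [set h | I (h + x)] _)) => h /= Ih; rewrite !fg ?inE.
Qed.

Lemma derive_in_cvg {R : realType} {V : normedModType R} {I : set R}
    {f : R -> V} {x : R} : derivable_in I f x -> has_derive_in I f x (derive_in I f x).
Proof. by []. Qed.

Lemma has_derive_in_cst {R : realType} {V : normedModType R} (I : set R) (x : R) (c : V) :
  has_derive_in I (fun=> c) x 0.
Proof.
rewrite /has_derive_in /diffquot_in.
rewrite (_ : (fun _ => _) = fun=> 0); first exact: cvg_cst.
by apply/funext => h; rewrite subrr scaler0.
Qed.

Lemma has_derive_inD {R : realType} {V : normedModType R} {I : set R}
    {f g : R -> V} {x : R} {a b : V} :
  has_derive_in I f x a -> has_derive_in I g x b ->
  has_derive_in I (fun s => f s + g s) x (a + b).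
Proof.
move=> fa gb; rewrite /has_derive_in /diffquot_in.
rewrite (_ : (fun _ => _) = fun h => h^-1 *: (f (h + x) - f x) +
  h^-1 *: (g (h + x) - g x)); first exact: cvgD.
by apply/funext => h; rewrite -scalerDr opprD addrACA.
Qed.

Lemma has_derive_in_continuous {R : realType} {V : normedModType R} {I : set R}
    {f : R -> V} {x : R} {a : V} :
  has_derive_in I f x a ->
  (fun h => f (h + x)) @ within [set h | I (h + x)] 0^' --> f x.
Proof.
move=> fa; set F := within _ _.
have idF : (fun h : R => h) @ F --> (0 : R).
  apply: cvg_within_filter; exact: nbhs_dnbhs.
(* Off [h = 0], which the punctured filter excludes, [f (h + x)] is [h] times the difference
   quotient plus [f x]. *)
have : (fun h : R => h *: (h^-1 *: (f (h + x) - f x)) + f x) @ F --> 0 *: a + f x.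
  by apply: cvgD; [exact: cvgZ|exact: cvg_cst].
rewrite scale0r add0r; apply: cvg_trans; apply: near_eq_cvg.
have : F (fun h => h != 0)
  by exact: (@cvg_within _ 0^' _ _ _ (nbhs_dnbhs_neq (0 : R))).
apply: filterS => h /= h0.
by rewrite scalerA divff// scale1r subrK.
Qed.

(** The increment of [c] is paired with [f (h + x)] and that of [f] with [c x], so the limit also
    uses continuity of [f] along [I]. *)
Lemma has_derive_inZ {R : realType} {V : normedModType R} {I : set R}
    {c : R -> R} {f : R -> V} {x : R} {c' : R} {a : V} :
  has_derive_in I (c : R -> R^o) x c' -> has_derive_in I f x a ->
  has_derive_in I (fun s => c s *: f s) x (c' *: f x + c x *: a).
Proof.
move=> cc fa; rewrite /has_derive_in /diffquot_in.
rewrite (_ : (fun _ => _) = fun h => (h^-1 * (c (h + x) - c x)) *: f (h + x) +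
  c x *: (h^-1 *: (f (h + x) - f x))).
  apply: cvgD; last exact: cvgZl_tmp.
  by apply: cvgZ => //; exact: has_derive_in_continuous fa.
apply/funext => h.
rewrite [c x *: (_ *: _)]scalerA [c x * _]mulrC -!scalerA -scalerDr; congr (_ *: _).
by rewrite scalerBl scalerBr addrA subrK.
Qed.

(** Taken over [setT], the rules for relative derivatives also serve the variable [v], where the
    derivative is the ordinary one. *)
Lemma derive1_has_derive_in {R : realType} {V : normedModType R} {f : R -> V} {x : R}
    {l : V} : has_derive_in setT f x l -> derive1 f x = l.
Proof.
move=> fl; rewrite -(@derive_in_open _ _ setT)//; last exact: openT.
apply: has_derive_inE => //; split; first by move=> ? ?.
by exists 0, 1; split => //; exact: ltr01.
Qed.

Lemma is_derive_has_derive_in {R : realType} {V : normedModType R} {f : R -> V} {x : R}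
    {l : V} : is_derive x 1 f l -> has_derive_in setT f x l.
Proof.
move=> [df <-]; rewrite /has_derive_in diffquot_in_open//; last exact: openT.
move: df; rewrite /derivable /derive.
by rewrite (_ : (fun _ => _) = fun h : R => h^-1 *: (f (h + x) - f x))//; apply/funext => h;
  rewrite /= scaler1.
Qed.

(** * Inner product, normal projection and derivatives along circles *)

Lemma dotE {R : realType} (x y : 'rV[R]_4) : dot x y = \sum_i x 0 i * y 0 i.
Proof. by rewrite /dot !mxE; apply: eq_bigr => i _; rewrite mxE. Qed.

Lemma dotC {R : realType} (x y : 'rV[R]_4) : dot x y = dot y x.
Proof. by rewrite !dotE; apply: eq_bigr => i _; rewrite mulrC. Qed.

Lemma dotDl {R : realType} (x y z : 'rV[R]_4) : dot (x + y) z = dot x z + dot y z.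
Proof. by rewrite /dot mulmxDl mxE. Qed.

Lemma dotZl {R : realType} (a : R) (x y : 'rV[R]_4) : dot (a *: x) y = a * dot x y.
Proof. by rewrite /dot -scalemxAl mxE. Qed.

Lemma dotNl {R : realType} (x y : 'rV[R]_4) : dot (- x) y = - dot x y.
Proof. by rewrite -scaleN1r dotZl mulN1r. Qed.

Lemma dotDr {R : realType} (x y z : 'rV[R]_4) : dot z (x + y) = dot z x + dot z y.
Proof. by rewrite dotC dotDl !(dotC z). Qed.

Lemma dotZr {R : realType} (a : R) (x y : 'rV[R]_4) : dot y (a *: x) = a * dot y x.
Proof. by rewrite dotC dotZl dotC. Qed.

Lemma dot0l {R : realType} (x : 'rV[R]_4) : dot 0 x = 0.
Proof. by rewrite /dot mul0mx mxE. Qed.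

Lemma dotNr {R : realType} (x y : 'rV[R]_4) : dot y (- x) = - dot y x.
Proof. by rewrite dotC dotNl dotC. Qed.

Lemma dot_eq0 {R : realType} (x : 'rV[R]_4) : (dot x x == 0) = (x == 0).
Proof.
rewrite dotE psumr_eq0 => [|i _]; last by rewrite -expr2 sqr_ge0.
apply/allP/eqP => [x0|-> i _]; last by rewrite mxE mulr0 eqxx.
apply/rowP => i; have := x0 i (mem_index_enum _).
by rewrite mxE -expr2 sqrf_eq0 => /eqP.
Qed.

(** Pairing with a fixed vector is a finite sum of continuous coordinates, so it commutes with the
    limit. *)
Lemma has_derive_in_dot {R : realType} {I : set R} {f : R -> 'rV[R]_4} {x : R}
    {a : 'rV[R]_4} (e : 'rV[R]_4) :
  has_derive_in I f x a -> has_derive_in I (fun s => dot (f s) e : R^o) x (dot a e).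
Proof.
move=> fa; rewrite /has_derive_in /diffquot_in.
rewrite (_ : (fun _ => _) = fun h => \sum_i (h^-1 *: (f (h + x) - f x)) 0 i * e 0 i).
  rewrite dotE; apply: cvg_big => [|i _]; first exact: add_continuous.
   apply: cvgMr_tmp.
  exact: (cvg_comp _ (fun M : 'rV[R]_4 => M 0 i) fa (@coord_continuous R 1 4 0 i a)).
by apply/funext => h; rewrite -dotE dotZl dotDl dotNl.
Qed.

(** The tangent space meets its orthogonal complement only in 0, so the projection fixes [a] and
    kills the tangential remainder. Normal components can thus be read off any such splitting. *)
Lemma normal_componentE {R : realType} (I : set R) (X : R -> R -> 'rV[R]_4)
    (u v : R) (w a : 'rV[R]_4) (x y : R) :
  dot a (du I X u v) = 0 -> dot a (dv X u v) = 0 ->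
  w = a + (x *: du I X u v + y *: dv X u v) -> normal_component I X u v w = a.
Proof.
move=> au av ->; rewrite /normal_component.
set S := tangent_space I X u v.
have SE : (S :=: du I X u v + dv X u v)%MS by exact: eqmx_trans (genmxE _) (eqmx_sym (addsmxE _ _)).
(* A vector [z] in both spaces is [D *m S] with [z *m S^T = 0], hence [dot z z = 0]. *)
have dis : (kermx S^T :&: S)%MS = 0.
  apply/eqP/rowV0P => z; rewrite sub_capmx => /andP[/sub_kermxP zk /submxP[D zE]].
  by apply/eqP; rewrite -dot_eq0 /dot {2}zE trmx_mul mulmxA zk mul0mx mxE.
have aK : (a <= kermx S^T)%MS.
  apply/sub_kermxP; have /submxP[D ->] : (S <= col_mx (du I X u v) (dv X u v))%MS.
    by rewrite genmxE.
  rewrite trmx_mul mulmxA tr_col_mx mul_mx_row.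
  have dot0 z : dot a z = 0 -> a *m z^T = 0.
    by move=> az; rewrite [LHS]mx11_scalar [X in X%:M]az raddf0.
  by rewrite !dot0// row_mx0 mul0mx.
rewrite mulmxDl proj_mx_id// proj_mx_0 ?addr0// SE.
by rewrite addmx_sub_adds// scalemx_sub.
Qed.

(** The surface, [X_u] and [X_v] all have this shape in [v], so it yields every [v]-derivative that
    is needed. *)
Lemma derive1_circle {R : realType} {V : normedModType R} (a A B : V) (c v : R) :
  derive1 (fun w => a + c *: (cos w *: A + sin w *: B)) v =
  c *: (- sin v *: A + cos v *: B).
Proof.
have dcos := is_derive_has_derive_in (is_derive_cos v).
have dsin := is_derive_has_derive_in (is_derive_sin v).
have dcst := @has_derive_in_cst R V setT v.
have dc := @has_derive_in_cst R R^o setT v c.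
apply: derive1_has_derive_in.
have := has_derive_inD (dcst a) (has_derive_inZ dc
  (has_derive_inD (has_derive_inZ dcos (dcst A)) (has_derive_inZ dsin (dcst B)))).
by rewrite scale0r !scaler0 !addr0 !add0r.
Qed.

(** * The frame along a straight line *)

Section StraightLine.
Context {R : realType} {I : set R} {gamma T M1 M2 M3 : R -> 'rV[R]_4} {k1 k2 k3 : R -> R}.
Hypothesis hI : interval_domain I.
Hypothesis hgamma : smooth_in I gamma.
Hypothesis hframe : parallel_transport_frame I gamma T M1 M2 M3 k1 k2 k3.
Hypothesis hline : straight_line I gamma.

Lemma frame_dots (u : R) : I u ->
  [/\ [/\ dot (T u) (T u) = 1, dot (M1 u) (M1 u) = 1, dot (M2 u) (M2 u) = 1
      & dot (M3 u) (M3 u) = 1],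
      [/\ dot (T u) (M1 u) = 0, dot (T u) (M2 u) = 0 & dot (T u) (M3 u) = 0]
    & [/\ dot (M1 u) (M2 u) = 0, dot (M1 u) (M3 u) = 0 & dot (M2 u) (M3 u) = 0]].
Proof.
move=> Iu; have on := frame_orthonormal hframe Iu.
have := (on (@Ordinal 4 0 isT) (@Ordinal 4 0 isT), on (@Ordinal 4 1 isT) (@Ordinal 4 1 isT),
  on (@Ordinal 4 2 isT) (@Ordinal 4 2 isT), on (@Ordinal 4 3 isT) (@Ordinal 4 3 isT),
  (on (@Ordinal 4 0 isT) (@Ordinal 4 1 isT), on (@Ordinal 4 0 isT) (@Ordinal 4 2 isT),
  on (@Ordinal 4 0 isT) (@Ordinal 4 3 isT)),
  (on (@Ordinal 4 1 isT) (@Ordinal 4 2 isT), on (@Ordinal 4 1 isT) (@Ordinal 4 3 isT),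
  on (@Ordinal 4 2 isT) (@Ordinal 4 3 isT))).
by rewrite !(tnth_nth 0) /= => -[[[[[-> ->] -> ->]] [[-> ->] ->]] [[-> ->] ->]].
Qed.

Lemma has_derive_in_gamma (u : R) : I u -> has_derive_in I gamma u (T u).
Proof. by move=> Iu; rewrite (frame_tangent hframe Iu); exact: (hgamma 0%N u Iu). Qed.

(** The position [t] on the line is only known to exist pointwise, so it is not differentiated.
    Instead [gamma] is paired with vectors [e] orthogonal to [d], which gives a constant. *)
Lemma line_tangent_derive0 (u : R) : I u -> derive_in I T u = 0.
Proof.
move=> Iu; have [p [d [d0 line]]] := hline.
have [sT _ _ _] := frame_smooth hframe.
have perp e : dot d e = 0 -> forall s, I s -> dot (T s) e = 0.
  move=> de s Is; rewrite -(has_derive_inE hI Is (has_derive_in_dot e (has_derive_in_gamma s Is))).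
  apply: has_derive_inE => //.
  apply: (has_derive_in_eq (fun=> dot p e)) => //; last exact: has_derive_in_cst.
  move=> x; rewrite inE => Ix; have [t ->] := line x Ix.
  by rewrite dotDl dotZl de mulr0 addr0.
have perp' e : dot d e = 0 -> dot (derive_in I T u) e = 0.
  move=> de; rewrite -(has_derive_inE hI Iu (has_derive_in_dot e (derive_in_cvg (sT 0%N u Iu)))).
  apply: has_derive_inE => //.
  apply: (has_derive_in_eq (fun=> 0)) => //; last exact: has_derive_in_cst.
  by move=> x; rewrite inE => Ix; exact: perp.
have [[TT _ _ _] [TM1 TM2 TM3] _] := frame_dots u Iu.
have dd : dot d d != 0 by rewrite dot_eq0.
(* [e] is the part of [T u] orthogonal to [d]; by [perp] it is also orthogonal to [T u], hence to
   itself, and so vanishes. *)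
pose c := dot (T u) d / dot d d.
pose e := T u - c *: d.
have de : dot d e = 0 by rewrite /e /c dotDr dotNr dotZr divfK// (dotC d) subrr.
have Te : T u = c *: d.
  apply/eqP; rewrite -subr_eq0 -/e -dot_eq0 {1}/e dotDl dotNl dotZl de mulr0 subr0.
  by rewrite perp.
(* As [T u] is a unit vector, [c] is nonzero, so a vector orthogonal to [T u] is orthogonal to [d].
   Applied below to [T'] itself, a combination of the [M_i]. *)
have dT' x : dot (T u) x = 0 -> dot (derive_in I T u) x = 0.
  move=> Tx; apply: perp'; apply/eqP.
  have : c * dot d x = 0 by rewrite -dotZl -Te.
  move=> /eqP; rewrite mulf_eq0 => /orP[/eqP c0|//].
  by move: TT; rewrite Te c0 scale0r dot0l => /eqP; rewrite eq_sym oner_eq0.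
apply/eqP; rewrite -dot_eq0; apply/eqP; apply: dT'.
by rewrite (frame_dT hframe Iu) !(dotDr, dotZr) TM1 TM2 TM3 !mulr0 !addr0.
Qed.

(** By orthonormality [k_i] is the inner product of [T'] with [M_i]. *)
Lemma line_curvatures0 (u : R) : I u -> [/\ k1 u = 0, k2 u = 0 & k3 u = 0].
Proof.
move=> Iu; have T'0 := line_tangent_derive0 u Iu.
have [[_ M11 M22 M33] _ [M12 M13 M23]] := frame_dots u Iu.
have dT x : dot (derive_in I T u) x = 0 by rewrite T'0 dot0l.
have := (dT (M1 u), dT (M2 u), dT (M3 u)).
rewrite (frame_dT hframe Iu) !(dotDl, dotZl) M11 M22 M33 (dotC (M2 u) (M1 u)).
rewrite (dotC (M3 u) (M1 u)) (dotC (M3 u) (M2 u)) M12 M13 M23.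
by rewrite !(mulr0, mulr1, addr0, add0r) => -[[-> ->] ->].
Qed.

(** * The canal surface around the line: partial derivatives, fundamental forms, curvatures *)

Context {r : R -> R}.
Hypothesis hr : smooth_in I r.
Hypothesis hreg : regular_surface I (canal_surface gamma M2 M3 r).

Let X := canal_surface gamma M2 M3 r.
Let r' := derive_in I r.
Let r'' := derive_in I r'.
(** [N] is the unit radial direction. The prime in [N'] stands for the derivative in [v], whereas in
    [r'] it is the one in [u]. [q] will be the coefficient [E]. *)
Let N u v := cos v *: M2 u + sin v *: M3 u.
Let N' u v := - sin v *: M2 u + cos v *: M3 u.
Let q u := 1 + r' u ^+ 2.

Lemma radial_dots (u v : R) : I u ->
  [/\ dot (N u v) (N u v) = 1, dot (N' u v) (N' u v) = 1, dot (N u v) (N' u v) = 0,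
      dot (T u) (N u v) = 0 & dot (T u) (N' u v) = 0].
Proof.
move=> Iu; have [[_ _ M22 M33] [_ TM2 TM3] [_ _ M23]] := frame_dots u Iu.
have cs := cos2Dsin2 v.
rewrite /N /N'; split;
  rewrite !(dotDl, dotDr, dotZl, dotZr) ?(dotC (M3 u)) ?M22 ?M33 ?M23 ?TM2 ?TM3; nra.
Qed.

Lemma has_derive_in_radial (u v : R) : I u -> has_derive_in I (fun s => N s v) u 0.
Proof.
move=> Iu; have [_ k20 k30] := line_curvatures0 u Iu.
have [_ _ s2 s3] := frame_smooth hframe.
have d2 := derive_in_cvg (s2 0%N u Iu); rewrite /= (frame_dM2 hframe Iu) in d2.
have d3 := derive_in_cvg (s3 0%N u Iu); rewrite /= (frame_dM3 hframe Iu) in d3.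
have dc c := @has_derive_in_cst R R^o I u c.
have := has_derive_inD (has_derive_inZ (dc (cos v)) d2) (has_derive_inZ (dc (sin v)) d3).
by rewrite k20 k30 oppr0 !scale0r !scaler0 !addr0.
Qed.

Lemma canal_du (u v : R) : I u -> du I X u v = T u + r' u *: N u v.
Proof.
move=> Iu; apply: (has_derive_inE hI Iu).
have := has_derive_inD (has_derive_in_gamma u Iu)
  (has_derive_inZ (derive_in_cvg (hr 0%N u Iu)) (has_derive_in_radial u v Iu)).
by rewrite scaler0 addr0.
Qed.

Lemma canal_dv (u v : R) : dv X u v = r u *: N' u v.
Proof. exact: derive1_circle. Qed.

Lemma canal_duu (u v : R) : I u -> du I (du I X) u v = r'' u *: N u v.
Proof.
move=> Iu; apply: (has_derive_inE hI Iu).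
apply: (has_derive_in_eq (fun s => T s + r' s *: N s v)) => //.
  by move=> s; rewrite inE => Is; exact: canal_du.
have [sT _ _ _] := frame_smooth hframe.
(* Smoothness at index 1 is derivability of the first derivative, here [r']. *)
have := has_derive_inD (derive_in_cvg (sT 0%N u Iu))
  (has_derive_inZ (derive_in_cvg (hr 1%N u Iu)) (has_derive_in_radial u v Iu)).
by rewrite /= line_tangent_derive0// scaler0 addr0 add0r.
Qed.

Lemma canal_duv (u v : R) : I u -> dv (du I X) u v = r' u *: N' u v.
Proof.
move=> Iu; rewrite /dv (_ : du I X u = fun w => T u + r' u *: N u w).
  exact: derive1_circle.
by apply/funext => w; exact: canal_du.
Qed.

Lemma canal_dvv (u v : R) : dv (dv X) u v = - r u *: N u v.
Proof.
(* [N'] is recast as a circle in the basis [M3], [- M2] about the origin, so that [derive1_circle]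
   applies again. *)
rewrite [LHS]/dv (_ : dv X u = fun w => 0 + r u *: (cos w *: M3 u + sin w *: - M2 u)).
  by rewrite derive1_circle /N; apply/rowP => i; rewrite !mxE; ring.
by apply/funext => w; rewrite canal_dv add0r /N' scalerN scaleNr addrC.
Qed.

Lemma canal_ff (u v : R) : I u ->
  [/\ ffE I X u v = q u, ffF I X u v = 0 & ffG X u v = r u ^+ 2].
Proof.
move=> Iu; rewrite /ffE /ffF /ffG canal_du// canal_dv.
move: (N u v) (N' u v) (radial_dots u v Iu) => n n' [nn n'n' nn' tn tn'].
have [[TT _ _ _] _ _] := frame_dots u Iu.
rewrite !(dotDl, dotDr, dotZl, dotZr) (dotC n (T u)) TT nn n'n' nn' tn tn' /q.
by split; ring.
Qed.

Lemma canal_q_gt0 (u : R) : 0 < q u.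
Proof. by rewrite ltr_pwDl// sqr_ge0. Qed.

(** Since [F = 0], [W^2 = q r^2]; regularity at any one angle, here 0, suffices. *)
Lemma canal_radius_neq0 (u : R) : I u -> r u != 0.
Proof.
move=> Iu; have := hreg u 0 Iu; rewrite /W2 -/X.
have [-> -> ->] := canal_ff u 0 Iu; apply: contra_neq => ->.
by rewrite !expr0n /= mulr0 subr0.
Qed.

(** [nu] is [- sqrt q] times the unit normal, which keeps square roots out of the
    second fundamental form. *)
Let nu u v := N u v - r' u *: T u.

Lemma canal_nu (u v : R) : I u ->
  [/\ dot (nu u v) (nu u v) = q u, dot (nu u v) (du I X u v) = 0
    & dot (nu u v) (dv X u v) = 0].
Proof.
move=> Iu; rewrite canal_du// canal_dv /nu.
move: (N u v) (N' u v) (radial_dots u v Iu) => n n' [nn n'n' nn' tn tn'].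
have [[TT _ _ _] _ _] := frame_dots u Iu.
rewrite !(dotDl, dotDr, dotNl, dotNr, dotZl, dotZr) (dotC n (T u)) TT nn nn' tn tn' /q.
by split; ring.
Qed.

(** From [q N = nu + r' X_u] one splits [X_uu = r'' N] and [X_vv = - r N] into normal and tangential
    parts, while [X_uv = (r' / r) X_v] is purely tangential. *)
Lemma canal_second_form (u v : R) : I u ->
  [/\ huu I X u v = (r'' u / q u) *: nu u v, huv I X u v = 0
    & hvv I X u v = - (r u / q u) *: nu u v].
Proof.
move=> Iu; have [_ nuu nuv] := canal_nu u v Iu.
have q0 := lt0r_neq0 (canal_q_gt0 u); have r0 := canal_radius_neq0 u Iu.
split.
- apply: (@normal_componentE _ _ _ _ _ _ _ (r'' u * r' u / q u) 0).
  + by rewrite dotZl nuu mulr0.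
  + by rewrite dotZl nuv mulr0.
  + rewrite canal_duu// canal_du// scale0r addr0 /nu.
    by apply/rowP => i; rewrite !mxE; move: q0; rewrite /q => q0; field.
- apply: (@normal_componentE _ _ _ _ _ _ _ 0 (r' u / r u)).
  + by rewrite dot0l.
  + by rewrite dot0l.
  + by rewrite canal_duv// canal_dv scale0r !add0r scalerA divfK.
- apply: (@normal_componentE _ _ _ _ _ _ _ (- (r u * r' u / q u)) 0).
  + by rewrite dotZl nuu mulr0.
  + by rewrite dotZl nuv mulr0.
  + rewrite canal_dvv canal_du// scale0r addr0 /nu.
    by apply/rowP => i; rewrite !mxE; move: q0; rewrite /q => q0; field.
Qed.

Lemma canal_gaussian_curvature (u v : R) : I u ->
  gaussian_curvature I X u v = - r'' u / (r u * q u ^+ 2).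
Proof.
move=> Iu; rewrite /gaussian_curvature /W2.
have q0 := lt0r_neq0 (canal_q_gt0 u); have r0 := canal_radius_neq0 u Iu.
have [-> -> ->] := canal_ff u v Iu; have [-> -> ->] := canal_second_form u v Iu.
have [nn _ _] := canal_nu u v Iu.
rewrite !(dotZl, dotZr) nn dot0l subr0 expr0n subr0.
by field; rewrite q0.
Qed.

Lemma canal_mean_curvature_vector (u v : R) : I u ->
  mean_curvature_vector I X u v =
  ((q u - r u * r'' u) / (2 * r u * q u * Num.sqrt (q u))) *: canal_normal I T M2 M3 r u v.
Proof.
move=> Iu; rewrite /mean_curvature_vector /W2.
have q0 := lt0r_neq0 (canal_q_gt0 u); have r0 := canal_radius_neq0 u Iu.
have [-> -> ->] := canal_ff u v Iu; have [-> -> ->] := canal_second_form u v Iu.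
have -> : canal_normal I T M2 M3 r u v = - (Num.sqrt (q u))^-1 *: nu u v.
  rewrite /canal_normal -/r' -/(q u) scaleNr -scalerN; congr (_ *: _).
  by rewrite /nu /N opprB opprD addrA.
have s2 : Num.sqrt (q u) ^+ 2 = q u by rewrite sqr_sqrtr// ltW// canal_q_gt0.
have s0 : Num.sqrt (q u) != 0 by rewrite sqrtr_eq0 -ltNge canal_q_gt0.
rewrite scaler0 subr0 !scalerA -scalerDl scalerA; congr (_ *: _).
(* Replacing [q] by the square of its root [s] turns the goal into an identity of rational
   functions. *)
move: (Num.sqrt _) s2 s0 => s <- s0.
by field; rewrite s0.
Qed.

(** This allows the normal to be cancelled, so that the vector equation determines [H]. *)
Lemma canal_normal_neq0 (u v : R) : I u -> canal_normal I T M2 M3 r u v != 0.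
Proof.
move=> Iu; rewrite -dot_eq0 /canal_normal -/r' -/(q u).
set m := (X in _ *: X).
have -> : m = - nu u v by rewrite /m /nu /N opprB opprD addrA.
have [nn _ _] := canal_nu u v Iu; have q0 := lt0r_neq0 (canal_q_gt0 u).
have s0 : (Num.sqrt (q u))^-1 != 0 by rewrite invr_eq0 sqrtr_eq0 -ltNge canal_q_gt0.
by rewrite dotZl dotZr dotNl dotNr opprK nn !mulf_neq0.
Qed.

End StraightLine.

Theorem proposition18 (R : realType) (I : set R)
    (gamma T M1 M2 M3 : R -> 'rV[R]_4) (k1 k2 k3 r : R -> R)
    (hI : interval_domain I)
    (hgamma : smooth_in I gamma)
    (hspeed : unit_speed I gamma)
    (hframe : parallel_transport_frame I gamma T M1 M2 M3 k1 k2 k3)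
    (hr : smooth_in I r)
    (hreg : regular_surface I (canal_surface gamma M2 M3 r))
    (hline : straight_line I gamma) :
  let X := canal_surface gamma M2 M3 r in
  let n := canal_normal I T M2 M3 r in
  (exists H : R -> R -> R, is_mean_curvature I X n H) /\
  (forall H : R -> R -> R, is_mean_curvature I X n H ->
     weingarten I (gaussian_curvature I X) H).
Proof.
move=> X n.
have HE u v := canal_mean_curvature_vector hI hgamma hframe hline hr hreg u v.
have KE u v := canal_gaussian_curvature hI hgamma hframe hline hr hreg u v.
split; first by eexists => u v Iu; exact: HE.
move=> H hH u v Iu.
have dv0 (f : R -> R -> R) c : (forall w, f u w = c) -> dv f u v = 0.
  by move=> fc; rewrite /dv (_ : f u = cst c) ?derive1_cst//; exact/funext.
(* Cancelling the normal identifies the given [H] with the explicit coefficient, in which [w] does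
   not occur. *)
have [c Hc] : exists c, forall w, H u w = c.
  eexists => w; have /eqP := hH u w Iu; rewrite HE// -subr_eq0 -scalerBl scaler_eq0.
  by rewrite (negPf (canal_normal_neq0 hI hgamma hframe hline hr u w Iu)) orbF subr_eq0 => /eqP <-.
(* Each product in the Jacobian has a [v]-derivative as a factor, so nothing about the
   [u]-derivatives of [K] and [H] is required. *)
by rewrite (dv0 (gaussian_curvature I X) _ (fun w => KE u w Iu)) (dv0 H c)// mulr0 mul0r subr0.
Qed.
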